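(* Let $\mathcal{D}$ be a monotone hazard rate (MHR) distribution, continuous and supported on $[0,x^* )$ with $x^*\le+\infty$, with cdf $F$. (1) If $F\in D_\gamma$ for maxima (I.I.D. Max-Prophet Inequality), then $\gamma\le 0$. (2) If $F\in D_\gamma$ for minima (I.I.D. Min-Prophet Inequality), then $\gamma\ge -1$.
   Context: $\mathcal{D}$ has cdf $F$ and density $f$; its support has left endpoint $0$ and right endpoint $x^*$. $\mathcal{D}$ is MHR if its hazard rate $h(x)=f(x)/(1-F(x))$ is non-decreasing on the support. Domain of attraction. For maxima, $F\in D_\gamma$ means there exist sequences $a_n>0$, $b_n\in\mathbb{R}$ with $\lim_{n\to\infty}F^n(a_nx+b_n)=G_\gamma(x)$, where $G_\gamma(x)=\exp(-(1+\gamma x)^{-1/\gamma})$ for $1+\gamma x>0$ if $\gamma\ne0$, and $G_0(x)=\exp(-e^{-x})$. For minima, $F\in D_\gamma$ means there exist $a'_n>0$, $b'_n\in\mathbb{R}$ with $\lim_{n\to\infty}(1-F(a'_nx+b'_n))^n=G^*_\gamma(x)$, where $G^*_\gamma(x)=\exp(-(1-\gamma x)^{-1/\gamma})$ for $1-\gamma x>0$ if $\gamma\neq0$, and $G^*_0(x)=\exp(-e^{x})$. *)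

(* Defs.v *)
From HB Require Import structures.
From mathcomp Require Import all_boot all_order all_algebra.
From mathcomp Require Import all_classical all_reals all_analysis.
Set Implicit Arguments.
Unset Strict Implicit.
Unset Printing Implicit Defensive.
Import Order.TTheory GRing.Theory Num.Theory.
Import numFieldNormedType.Exports.
Local Open Scope classical_set_scope.
Local Open Scope ring_scope.

Section Distributions.
Context {R : realType}.
Implicit Types (D : probability (measurableTypeR R) R) (f F : R -> R).

(* The real-valued version of [cdf] for the identity random variable on
   [(R, D)]. *)
Definition dist_cdf D (x : R) : R := fine (D `]-oo, x]%classic).

(* [f] is one fixed version of the density of [D]; this entails that [D] is
   (absolutely) continuous. *)
Definition is_density D f : Prop :=
  [/\ measurable_fun [set: R] f,
      (forall x, 0 <= f x) &
      (forall A : set R, measurable A ->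
        D A = (\int[lebesgue_measure]_(x in A) (f x)%:E)%E)].

Definition dist_support D : set R :=
  [set x | forall U : set R, open U -> U x -> (0 < D U)%E].

(* The interval [0, xs) of R, where [xs] may be +oo. *)
Definition itv0 (xs : \bar R) : set R := [set x | 0 <= x /\ (x%:E < xs)%E].

(* The topological support is closed, so it also contains [xs] when [xs] is
   finite. *)
Definition supported_on0 D (xs : \bar R) : Prop :=
  (0 < xs)%E /\ dist_support D = closure (itv0 xs).

Definition hazard D f (x : R) : R := f x / (1 - dist_cdf D x).

(* Monotonicity is only required on [0, xs): at a finite [xs] one has
   [1 - F xs = 0] and the hazard rate is undefined. *)
Definition MHR D f (xs : \bar R) : Prop :=
  {in itv0 xs &, {homo hazard D f : x y / x <= y}}.

Definition GEV_max (gamma x : R) : R :=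
  if gamma == 0 then expR (- expR (- x))
  else expR (- ((1 + gamma * x) `^ (- gamma^-1))).

Definition GEV_min (gamma x : R) : R :=
  if gamma == 0 then expR (- expR x)
  else expR (- ((1 - gamma * x) `^ (- gamma^-1))).

(* Convergence is required exactly where the limit law is given by its
   formula; for [gamma = 0] the side conditions hold for every [x]. *)
Definition max_attraction F (gamma : R) : Prop :=
  exists a b : nat -> R,
    (forall n, 0 < a n) /\
    (forall x, 0 < 1 + gamma * x ->
      F (a n * x + b n) ^+ n @[n --> \oo] --> GEV_max gamma x).

Definition min_attraction F (gamma : R) : Prop :=
  exists a b : nat -> R,
    (forall n, 0 < a n) /\
    (forall x, 0 < 1 - gamma * x ->
      (1 - F (a n * x + b n)) ^+ n @[n --> \oo] --> GEV_min gamma x).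

End Distributions.

(* Main.v *)
(* Write [S = 1 - F]. Since [f = h * S] on [0, xs), monotonicity of [h]
   compares the increments of [S] on either side of a point [y] with [h y],
   and this makes [S] midpoint log-concave on the half-line: [S (y - d) * S
   (y + d) <= S y ^+ 2]. The inequality survives in the limit law along any
   three equidistant points, since points that stay relevant in the limit are
   eventually positive. For minima it passes through the [n]-th power and
   says that [(1 - gamma x) ^ (- 1 / gamma)] is midpoint convex, whereas it
   is strictly concave when [gamma < -1]. For maxima it passes through [n *
   S], which tends to [(1 + gamma x) ^ (- 1 / gamma)], a strictly log-convex
   function when [0 < gamma]. *)
Require Import Defs.
From mathcomp Require Import all_boot all_order all_algebra.
From mathcomp Require Import all_classical all_reals all_analysis.
From mathcomp Require Import measurable_realfun ring lra.
Import Order.TTheory GRing.Theory Num.Theory.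
Import numFieldNormedType.Exports.
Set Implicit Arguments.
Unset Strict Implicit.
Unset Printing Implicit Defensive.
Local Open Scope classical_set_scope.
Local Open Scope ring_scope.

(** * Elementary real inequalities and a limit lemma *)

Lemma bernoulli_le (R : realDomainType) (e : R) n :
  0 <= e <= 1 -> 1 - n%:R * e <= (1 - e) ^+ n.
Proof.
move=> /andP[e0 e1]; elim: n => [|n IHn]; first by rewrite mul0r subr0 expr0.
have n0 : 0 <= n%:R * e ^+ 2 by rewrite mulr_ge0 ?sqr_ge0.
rewrite exprS (le_trans _ (ler_wpM2l _ IHn)) ?subr_ge0// -natr1.
rewrite -subr_ge0; apply: le_trans n0 _.
by rewrite le_eqVlt; apply/orP; left; apply/eqP; ring.
Qed.

(* Both halves are cut into [N] equal steps; with [t = l * d] this gives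
   [S y >= S (y - d) * (1 - t / N) ^ N] and
   [S y >= S (y + d) * (1 + t / N) ^ N], and the product of the two factors
   tends to [1]. *)
Lemma midpoint_log_concave (R : archiRealFieldType) (S : R -> R) (y d l : R) :
  0 <= d -> 0 <= l -> (forall x, 0 <= S x) ->
  (forall u v, y - d <= u -> u <= v -> v <= y ->
    S u * (1 - l * (v - u)) <= S v) ->
  (forall u v, y <= u -> u <= v -> v <= y + d ->
    S v * (1 + l * (v - u)) <= S u) ->
  S (y - d) * S (y + d) <= S y ^+ 2.
Proof.
move=> d0 l0 S0 HL HR.
(* The inequality up to a relative error [t ^ 2 / N] with [t = l * d]; the condition on [N] keeps
   the factor [1 - t / N] nonnegative. *)
have key N : l * d < N%:R -> 
    S (y - d) * S (y + d) * (1 - (l * d) ^+ 2 / N%:R) <= S y ^+ 2.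
  move=> ltN.
  have t0 : 0 <= l * d by rewrite mulr_ge0.
  have N0 : 0 < N%:R :> R by apply: le_lt_trans ltN.
  have Nn0 : N%:R != 0 :> R by rewrite gt_eqF.
  set e := d / N%:R.
  have e0 : 0 <= e by rewrite divr_ge0// ltW.
  have eN : N%:R * e = d by rewrite mulrC divfK.
  have le0 : 0 <= l * e by rewrite mulr_ge0.
  have le1 : l * e <= 1 by rewrite mulrA ler_pdivrMr// mul1r ltW.
  have bnd k : (k <= N)%N -> k%:R * e <= d.
    by move=> kN; rewrite -[leRHS]eN ler_wpM2r// ler_nat.
  have HLk k : (k <= N)%N -> 
      S (y - d) * (1 - l * e) ^+ k <= S (y - d + k%:R * e).
    elim: k => [|k IHk] kN; first by rewrite mul0r addr0 expr0 mulr1.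
    have kb := bnd _ kN; have k0 : 0 <= k%:R * e by rewrite mulr_ge0.
    have := HL (y - d + k%:R * e) (y - d + k.+1%:R * e).
    rewrite -natr1 in kb *.
    have -> : y - d + (k%:R + 1) * e - (y - d + k%:R * e) = e by ring.
    move=> H; apply: le_trans (H _ _ _); [|lra|lra|lra].
    rewrite exprSr mulrA ler_wpM2r ?subr_ge0//; apply: IHk; exact: ltnW.
  have HRk k : (k <= N)%N -> S (y + k%:R * e) * (1 + l * e) ^+ k <= S y.
    elim: k => [|k IHk] kN; first by rewrite mul0r addr0 expr0 mulr1.
    have kb := bnd _ kN; have k0 : 0 <= k%:R * e by rewrite mulr_ge0.
    apply: le_trans (IHk (ltnW kN)).
    have := HR (y + k%:R * e) (y + k.+1%:R * e).
    rewrite -natr1 in kb *.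
    have -> : y + (k%:R + 1) * e - (y + k%:R * e) = e by ring.
    move=> H; rewrite exprS mulrA ler_wpM2r ?exprn_ge0 ?addr_ge0//.
    apply: H; lra.
  have {HLk} := HLk N (leqnn N); rewrite eN subrK => HLN.
  have {HRk} := HRk N (leqnn N); rewrite eN => HRN.
  have : S (y - d) * (1 - l * e) ^+ N * (S (y + d) * (1 + l * e) ^+ N)
      <= S y ^+ 2.
    by rewrite expr2 ler_pM ?mulr_ge0 ?exprn_ge0 ?subr_ge0 ?addr_ge0.
  apply: le_trans; rewrite mulrACA -exprMn ler_wpM2l ?mulr_ge0//.
  (* The first-order terms of the two factors cancel, so Bernoulli loses only
     [N * (t / N) ^ 2 = t ^ 2 / N]. *)
  have -> : (1 - l * e) * (1 + l * e) = 1 - (l * e) ^+ 2 by ring.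
  have -> : (l * d) ^+ 2 / N%:R = N%:R * (l * e) ^+ 2 by rewrite /e; field.
  by apply: bernoulli_le; rewrite sqr_ge0 expr_le1.
rewrite leNgt; apply/negP => lt.
set X := S (y - d) * S (y + d) in key lt; set B := S y ^+ 2 in key lt.
set t := l * d in key.
have t0 : 0 <= t by rewrite mulr_ge0.
have XB : 0 < X - B by rewrite subr_gt0.
have X0 : 0 <= X by rewrite mulr_ge0.
have q0 : 0 <= X * t ^+ 2 / (X - B).
  by rewrite divr_ge0 ?mulr_ge0 ?sqr_ge0 ?(ltW XB).
(* Both summands are nonnegative, so [N] exceeds each: the first makes [key] applicable, the second
   makes its error [X * t ^ 2 / N] smaller than the gap [X - B]. *)
pose N := Num.bound (t + X * t ^+ 2 / (X - B)).
have NP : t + X * t ^+ 2 / (X - B) < N%:R by rewrite archi_boundP// addr_ge0.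
have tN : t < N%:R by lra.
have qN : X * t ^+ 2 / (X - B) < N%:R by lra.
have N0 : 0 < N%:R :> R by apply: le_lt_trans tN.
move: qN; rewrite ltr_pdivrMr// => qN.
have := key _ tN; rewrite -(ler_pM2r N0).
have -> : X * (1 - t ^+ 2 / N%:R) * N%:R = X * N%:R - X * t ^+ 2.
  by field; rewrite gt_eqF.
lra.
Qed.

(** With [p = exp x], apply [1 + s < exp s] at [s = (1 - r) * x] and at [s = - r * x]. Weighting the
    results by [r] and [1 - r] cancels the terms linear in [x]. *)
Lemma powR_lt_tangent (R : realType) (p r : R) :
  0 < p -> p != 1 -> 0 < r < 1 -> p `^ r < 1 + r * (p - 1).
Proof.
move=> p0 p1 /andP[r0 r1].
have l0 : ln p != 0 by rewrite ln_eq0.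
have [x xl pE] : exists2 x, x != 0 & p = expR x by exists (ln p); rewrite ?lnK.
rewrite /powR gt_eqF// pE expRK.
have e0 := expR_gt0 (r * x).
have r1' : 0 < 1 - r by rewrite subr_gt0.
have H1 : expR (r * x) * (1 + (1 - r) * x) < expR x.
  have -> : expR x = expR (r * x) * expR ((1 - r) * x).
    by rewrite -expRD; congr expR; ring.
  by rewrite ltr_pM2l// expR_gt1Dx// mulf_neq0// gt_eqF.
have H2 : expR (r * x) * (1 - r * x) < 1.
  rewrite -[ltRHS](_ : expR (r * x) * expR (- (r * x)) = 1); last first.
    by rewrite -expRD subrr expR0.
  by rewrite ltr_pM2l// -mulNr expR_gt1Dx// mulf_neq0// lt_eqF// oppr_lt0.
move: H1 H2; rewrite -(ltr_pM2l r0) => H1; rewrite -(ltr_pM2l r1') => H2; lra.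
Qed.

(** Turns convergence of powers of the cdf into convergence of [n] times the tail. With
    [w n = - ln (u n ^ n)] and [t = w n / n] one has [u n = exp (- t)], and
    [t * (1 - t) <= 1 - exp (- t) <= t] squeezes the sequence between [w n * (1 - w n / n)] and
    [w n]. *)
Lemma cvg_compl_of_cvg_expn (R : realType) (u : nat -> R) (V : R) :
  (forall n, 0 <= u n <= 1) -> u n ^+ n @[n --> \oo] --> expR (- V) ->
  n%:R * (1 - u n) @[n --> \oo] --> V.
Proof.
move=> u01 uV.
pose w n := - ln (u n ^+ n).
have wV : w n @[n --> \oo] --> V.
  rewrite -[V]opprK -[X in _ --> - X]expRK; apply: cvgN.
  exact: continuous_cvg (continuous_ln (expR_gt0 _)) uV.
have iV : (n%:R^-1 : R) @[n --> \oo] --> (0 : R).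
  rewrite -cvg_shiftS; exact: cvg_harmonic.
have lV : w n * (1 - w n * n%:R^-1) @[n --> \oo] --> V.
  rewrite (_ : V = V * (1 - V * 0)); last by rewrite mulr0 subr0 mulr1.
  by apply: cvgM => //; apply: cvgB; [exact: cvg_cst|exact: cvgM].
apply: squeeze_cvgr lV wV.
(* Since [ln] has the default value 0 at 0, [u n] is recovered from [w n] only where the power is
   positive. *)
have posu : \forall n \near \oo, 0 < u n ^+ n.
  by apply: (cvgr_gt _ uV); exact: expR_gt0.
apply: (filterS2 _ _ (nbhs_infty_gt 0%N) posu) => n n0 un0.
have /andP[u0 u1] := u01 n.
have n0' : 0 < n%:R :> R by rewrite ltr0n.
have uE : u n = expR (- (w n * n%:R^-1)).
  have up : 0 < u n.
    rewrite lt_neqAle u0 andbT eq_sym; apply: contraTneq un0 => ->.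
    by rewrite expr0n gtn_eqF// ltxx.
  by rewrite /w lnXn// -(mulr_natr (ln (u n))) mulNr opprK mulfK ?gt_eqF// lnK.
set t := w n * n%:R^-1 in uE *.
have -> : w n = n%:R * t by rewrite /t mulrC divfK ?gt_eqF.
rewrite uE -mulrA !ler_pM2l//.
have := expR_ge1Dx (- t).
have : expR (- t) * expR t = 1 by rewrite -expRD addNr expR0.
have := expR_ge1Dx t; have := expR_gt0 (- t); set E := expR (- t).
move=> E0 tE Et Et'; apply/andP; split; last lra.
have : E * (1 + t) <= 1 by rewrite -[leRHS]Et ler_pM2l.
have t0 : 0 <= t.
  by rewrite /t /w divr_ge0// oppr_ge0 ln_le0// exprn_ile1.
nra.
Qed.

(** * Support, cdf and survival function of a probability measure *)

(** A point outside the support has a null open neighbourhood, hence lies in a null interval with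
    rational endpoints, and there are countably many of these. [I] enumerates the rational intervals
    and [J] keeps the null ones. *)
Lemma negligible_setC_support (R : realType)
    (D : probability (measurableTypeR R) R) :
  D.-negligible (~` dist_support D).
Proof.
pose I (k : nat) : set R :=
  if unpickle k is Some (p, q) then `](ratr p : R), (ratr q : R)[%classic
  else set0.
pose J k : set R := if D (I k) == 0%E then I k else set0.
have mI k : measurable (I k) by rewrite /I; case: unpickle => [[p q]|].
apply: (@negligibleS _ _ _ D (\bigcup_k J k)); last first.
  apply: negligible_bigcup => k; rewrite /J; case: ifPn => [/eqP Ik0|_].
    by apply/negligibleP; first exact: mI.
  by apply/negligibleP.
move=> x /= /existsNP[U] /not_implyP[oU] /not_implyP[Ux] /negP.
rewrite -leNgt => DU.
have [e /= e0 eU] := (open_nbhs_nbhs (conj oU Ux)).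
have xl : x - e < x by rewrite ltrBlDr ltrDl.
have xr : x < x + e by rewrite ltrDl.
have [p] := rat_in_itvoo xl; rewrite in_itv/= => /andP[p1 p2].
have [q] := rat_in_itvoo xr; rewrite in_itv/= => /andP[q1 q2].
have Ipq : I (pickle (p, q)) = `](ratr p : R), (ratr q : R)[%classic.
  by rewrite /I pickleK.
exists (pickle (p, q)) => //; rewrite /J ifT; first by rewrite Ipq /= in_itv/= p2.
apply/eqP/le_anti; rewrite measure_ge0 andbT; apply: le_trans DU.
apply: le_measure; rewrite ?inE; [exact: mI|exact: open_measurable|].
rewrite Ipq => z /=; rewrite in_itv/= => /andP[z1 z2]; apply: eU => /=.
by rewrite ltr_distlC; apply/andP; split; [apply: lt_trans z1|apply: lt_trans q2].
Qed.

Definition tail (R : realType)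
    (D : probability (measurableTypeR R) R) (x : R) : R :=
  1 - dist_cdf D x.

Lemma dist_cdfE (R : realType)
    (D : probability (measurableTypeR R) R) (x : R) :
  (dist_cdf D x)%:E = D `]-oo, x]%classic.
Proof. by rewrite /dist_cdf fineK// fin_num_measure. Qed.

Lemma tailE (R : realType)
    (D : probability (measurableTypeR R) R) (x : R) :
  (tail D x)%:E = D `]x, +oo[%classic.
Proof. by rewrite -setCitvl probability_setC// -dist_cdfE. Qed.

Lemma dist_cdf_ge0 (R : realType)
    (D : probability (measurableTypeR R) R) (x : R) :
  0 <= dist_cdf D x.
Proof. by rewrite -lee_fin dist_cdfE. Qed.

Lemma tail_ge0 (R : realType)
    (D : probability (measurableTypeR R) R) (x : R) :
  0 <= tail D x.
Proof. by rewrite -lee_fin tailE. Qed.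

Lemma measure_itvoc (R : realType)
    (D : probability (measurableTypeR R) R) (u v : R) :
  u <= v -> D `]u, v]%classic = (tail D u - tail D v)%:E.
Proof.
move=> uv.
have : D `]-oo, v]%classic = (D `]-oo, u]%classic + D `]u, v]%classic)%E.
  rewrite (@itv_bndbnd_setU _ _ _ (BRight u)) ?bnd_simp//= measureU//.
  apply/seteqP; split => z //=; rewrite !in_itv/= => -[zu] /andP[uz _].
  by have := le_lt_trans zu uz; rewrite ltxx.
rewrite -(fineK (fin_num_measure D _ (measurable_itv `]u, v]))) -!dist_cdfE.
by rewrite -EFinD /tail => -[] ->; congr (_%:E); lra.
Qed.

Lemma tail_le (R : realType)
    (D : probability (measurableTypeR R) R) (u v : R) :
  u <= v -> tail D v <= tail D u.
Proof. by move=> uv; rewrite -subr_ge0 -lee_fin -measure_itvoc. Qed.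

Lemma integral_cst_itvoc (R : realType) (c u v : R) : u <= v ->
  (\int[lebesgue_measure]_(x in `]u, v]%classic) cst c%:E x)%E
  = (c * (v - u))%:E.
Proof.
move=> uv; rewrite integral_cst//= lebesgue_measure_itv/= lte_fin.
case: ifPn => //; rewrite -leNgt => vu.
by rewrite mule0 (le_anti (_ : u <= v <= u)) ?uv// subrr mulr0.
Qed.

(** * Increments of the survival function under bounds on the density *)

Section density.
Context {R : realType} (D : probability (measurableTypeR R) R) (f : R -> R).
Hypothesis Df : is_density D f.

Lemma density_set1 (x : R) : D [set x] = 0%E.
Proof. by case: Df => _ _ ->//; rewrite integral_set1. Qed.

Lemma density_tail_le (u v c : R) : u <= v ->
  (forall x, u < x <= v -> f x <= c) -> tail D u - tail D v <= c * (v - u).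
Proof.
case: Df => mf f0 fD uv fc; rewrite -lee_fin -measure_itvoc// fD//.
rewrite (@le_trans _ _
  (\int[lebesgue_measure]_(x in `]u, v]%classic) cst c%:E x)%E)//.
  apply: ge0_le_integral => //.
  - by move=> x _; rewrite lee_fin.
  - by apply/measurable_EFinP; exact: measurable_funTS.
by rewrite integral_cst_itvoc.
Qed.

Lemma density_tail_ge (u v c : R) : u <= v -> 0 <= c ->
  (forall x, u < x <= v -> c <= f x) -> c * (v - u) <= tail D u - tail D v.
Proof.
case: Df => mf f0 fD uv c0 fc; rewrite -lee_fin -measure_itvoc// fD//.
rewrite (@le_trans _ _
  (\int[lebesgue_measure]_(x in `]u, v]%classic) cst c%:E x)%E)//; last first.
  apply: ge0_le_integral => //.
  - by apply/measurable_EFinP; exact: measurable_funTS.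
by rewrite integral_cst_itvoc.
Qed.
End density.

(** * The survival function of an MHR distribution *)

Section mhr.
Context {R : realType} (D : probability (measurableTypeR R) R).
Context (f : R -> R) (xs : \bar R).
Hypothesis Df : is_density D f.
Hypothesis Dxs : supported_on0 D xs.
Hypothesis Dmhr : MHR D f xs.

(** The open ray beyond [x] is a neighbourhood of some support point [s] between [x] and [xs]. *)
Lemma tail_gt0 (x : R) : 0 <= x -> (x%:E < xs)%E -> 0 < tail D x.
Proof.
move=> x0 xxs; have [_ supp] := Dxs.
have [s [xs_ sxs]] : exists s, x < s /\ (s%:E < xs)%E.
  move: xxs; case: (xs) => [b||//]; rewrite ?lte_fin => xb.
    by exists ((x + b) / 2); rewrite lte_fin; split; lra.
  by exists (x + 1); rewrite ltry ltrDl.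
have : dist_support D s.
  by rewrite supp; apply: subset_closure; split=> //; lra.
move=> /(_ `]x, +oo[%classic); rewrite -tailE lte_fin; apply => //=.
by rewrite in_itv/= andbT.
Qed.

(** The support has full measure and, being the closure of [itv0 xs], lies in every closed ray
    containing that interval. *)
Lemma null_outside_support (A : set R) : measurable A ->
  (forall z, A z -> z < 0 \/ (xs < z%:E)%E) -> D A = 0%E.
Proof.
move=> mA HA; apply/negligibleP => //.
apply: (negligibleS _ (negligible_setC_support D)) => z Az.
have [xs0 ->] := Dxs; rewrite /= closureEbigcap => clz.
have [z0|xsz] := HA z Az.
  suff : `[0, +oo[%classic z by rewrite /= in_itv/= andbT leNgt z0.
  apply: clz; split; first exact: rray_closed.
  by move=> t [t0 _] /=; rewrite in_itv/= t0.
case: xs xsz xs0 clz => [b||//]; last by rewrite ltNge leey.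
rewrite lte_fin => bz _ clz.
suff : `]-oo, b]%classic z by rewrite /= in_itv/= leNgt bz.
apply: clz; split; first exact: lray_closed.
by move=> t [_ tb] /=; rewrite in_itv/= ltW.
Qed.

(** The open negative half-line misses the support, and the endpoint 0 carries no atom because there
    is a density. *)
Lemma dist_cdf_eq0 (x : R) : x <= 0 -> dist_cdf D x = 0.
Proof.
move=> x0; apply: le_anti; rewrite dist_cdf_ge0 andbT -lee_fin dist_cdfE.
have : D `]-oo, 0[%classic = 0%E.
  by apply: null_outside_support => // z /=; rewrite in_itv/=; left.
have /negligibleP-/(_ (measurable_set1 _)) n0 := density_set1 Df 0.
move=> /negligibleP-/(_ (measurable_itv _)) n1.
suff /negligibleP-/(_ (measurable_itv _)) -> : D.-negligible `]-oo, x]%classic by [].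
apply: (negligibleS _ (negligibleU n1 n0)) => z /=; rewrite !in_itv/= => zx.
have : z <= 0 by apply: le_trans x0.
by rewrite le_eqVlt => /orP[/eqP|]; [right|left].
Qed.

Lemma tail_eq0 (x : R) : (xs <= x%:E)%E -> tail D x = 0.
Proof.
move=> xsx; apply: le_anti; rewrite tail_ge0 andbT -lee_fin tailE.
rewrite null_outside_support// => z /=; rewrite in_itv/= andbT => xz; right.
by apply: le_lt_trans xsx _; rewrite lte_fin.
Qed.

Lemma tail_midpoint (y d : R) : 0 <= d -> d <= y ->
  tail D (y - d) * tail D (y + d) <= tail D y ^+ 2.
Proof.
move=> d0 dy; have [/tail_eq0 ->|yd] := leP xs (y + d)%:E.
  by rewrite mulr0 sqr_ge0.
have [_ f0 _] := Df.
have in0 x : 0 <= x -> x <= y + d -> x \in itv0 xs.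
  move=> x0 xyd; rewrite inE; split => //.
  by apply: le_lt_trans yd; rewrite lee_fin.
have t0 x : 0 <= x -> x <= y + d -> 0 < tail D x.
  by move=> x0 xyd; have /set_mem[] := in0 x x0 xyd; exact: tail_gt0.
have fE x : 0 <= x -> x <= y + d -> f x = hazard D f x * tail D x.
  by move=> x0 xyd; rewrite /hazard divfK// gt_eqF// t0.
have h0 : 0 <= hazard D f y by rewrite divr_ge0// tail_ge0.
(* The slope is the hazard rate at the midpoint. On []u, v]], [f = h * S] is at most [h y * S u] to
   the left of [y] and at least [h y * S v] to its right. *)
apply: (@midpoint_log_concave _ _ _ _ (hazard D f y)) => //; first exact: tail_ge0.
- move=> u v yu uv vy.
  suff : tail D u - tail D v <= hazard D f y * tail D u * (v - u) by lra.
  apply: (density_tail_le Df) => // x /andP[ux xv].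
  have x0 : 0 <= x by lra.
  have xyd : x <= y + d by lra.
  rewrite fE//; apply: ler_pM; [|exact: tail_ge0| |apply: tail_le; lra].
    by rewrite divr_ge0// tail_ge0.
  by apply: Dmhr; [apply: in0|apply: in0|]; lra.
- move=> u v yu uv vy.
  suff : hazard D f y * tail D v * (v - u) <= tail D u - tail D v by lra.
  apply: (density_tail_ge Df) => //; first by rewrite mulr_ge0// tail_ge0.
  move=> x /andP[ux xv].
  have x0 : 0 <= x by lra.
  have xyd : x <= y + d by lra.
  rewrite fE//; apply: ler_pM => //; [exact: tail_ge0| |apply: tail_le; lra].
  by apply: Dmhr; [apply: in0|apply: in0|]; lra.
Qed.

(** * Minima *)

Lemma min_attraction_ge (gamma : R) :
  min_attraction (dist_cdf D) gamma -> -1 <= gamma.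
Proof.
move=> [a [b [a0 ab]]]; rewrite leNgt; apply/negP => g1.
have g0 : gamma != 0 by rewrite lt_eqF//; lra.
pose r := - gamma^-1.
have r01 : 0 < r < 1.
  have : - r * gamma = 1 by rewrite /r opprK mulVf.
  by move=> ?; apply/andP; split; nra.
(* This spacing places the limit law at [c = 1, 0, -1] on the bases [1/2, 1, 3/2]. Since [e < 0],
   the leftmost point is [c = 1]. *)
pose e := (2 * gamma)^-1.
have e0 : e < 0 by rewrite invr_lt0; lra.
have ge : gamma * e = 2^-1 by rewrite /e; field.
have lim (c : R) : -1 <= c <= 1 ->
    tail D (b n + a n * e * c) ^+ n @[n --> \oo]
      --> expR (- ((1 - c / 2) `^ r)).
  move=> /andP[c1 c2].
  have gec : gamma * (e * c) = c / 2 by rewrite mulrA ge mulrC.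
  have -> : (fun n => tail D (b n + a n * e * c) ^+ n)
      = (fun n => (1 - dist_cdf D (a n * (e * c) + b n)) ^+ n).
    by apply/funext => n; rewrite [a n * (e * c) + _]addrC mulrA.
  by have := ab (e * c); rewrite /GEV_min (negbTE g0) gec; apply; lra.
have l1 : -1 <= (1 : R) <= 1 by apply/andP; split; lra.
have lN : -1 <= (-1 : R) <= 1 by apply/andP; split; lra.
have l0 : -1 <= (0 : R) <= 1 by apply/andP; split; lra.
(* If the leftmost point were nonpositive, the tail there and its power would equal 1, while the
   limit is below 1. *)
have eL : \forall n \near \oo, 0 < b n + a n * e.
  have : expR (- ((1 - 1 / 2) `^ r)) < 1 :> R.
    by rewrite expR_lt1 oppr_lt0 powR_gt0//; lra.
  move=> /(cvgr_lt _ (lim _ l1)) ltF; apply: filterS ltF => n; rewrite mulr1.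
  apply: contraTT; rewrite -!leNgt => h.
  by rewrite /tail (dist_cdf_eq0 h) subr0 expr1n.
have : expR (- ((1 - 1 / 2) `^ r)) * expR (- ((1 - -1 / 2) `^ r))
    <= expR (- ((1 - 0 / 2) `^ r)) * expR (- ((1 - 0 / 2) `^ r)).
  apply: (ler_cvg_to (cvgM (lim _ l1) (lim _ lN)) (cvgM (lim _ l0) (lim _ l0))).
  apply: (filterS _ eL) => n bn /=.
  rewrite mulr1 mulr0 addr0 mulrN1 -!exprMn.
  rewrite lerXn2r ?nnegrE ?mulr_ge0 ?tail_ge0// -expr2.
  have := @tail_midpoint (b n) (- (a n * e)).
  rewrite opprK; apply; last lra.
  by rewrite -mulrN mulr_ge0 ?oppr_ge0 ?ltW.
(* The limit inequality now reads [(1/2) ^ r + (3/2) ^ r >= 2]. The tangent at 1 bounds the summands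
   strictly by [1 - r / 2] and [1 + r / 2], a contradiction. *)
rewrite -!expRD ler_expR mul0r subr0 powR1.
have := @powR_lt_tangent R (1 - 1 / 2) r.
have := @powR_lt_tangent R (1 - -1 / 2) r.
move=> /(_ _ _ r01) H1 /(_ _ _ r01) H2.
have {}H1 := H1 ltac:(lra) ltac:(lra).
have {}H2 := H2 ltac:(lra) ltac:(lra).
lra.
Qed.

(** * Maxima *)

Lemma max_attraction_le (gamma : R) :
  max_attraction (dist_cdf D) gamma -> gamma <= 0.
Proof.
move=> [a [b [a0 ab]]]; rewrite leNgt; apply/negP => g0.
have gn0 : gamma != 0 by rewrite gt_eqF.
pose r := - gamma^-1.
have r0 : r < 0 by rewrite oppr_lt0 invr_gt0.
(* Here [e > 0], so [c = -1, 0, 1] gives the bases [1/2, 1, 3/2] and the leftmost point is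
   [c = -1]. *)
pose e := (2 * gamma)^-1.
have e0 : 0 < e by rewrite invr_gt0; lra.
have ge : gamma * e = 2^-1 by rewrite /e; field.
have lim (c : R) : -1 <= c <= 1 ->
    dist_cdf D (b n + a n * e * c) ^+ n @[n --> \oo]
      --> expR (- ((1 + c / 2) `^ r)).
  move=> /andP[c1 c2].
  have gec : gamma * (e * c) = c / 2 by rewrite mulrA ge mulrC.
  have -> : (fun n => dist_cdf D (b n + a n * e * c) ^+ n)
      = (fun n => dist_cdf D (a n * (e * c) + b n) ^+ n).
    by apply/funext => n; rewrite [a n * (e * c) + _]addrC mulrA.
  by have := ab (e * c); rewrite /GEV_max (negbTE gn0) gec; apply; lra.
have limS (c : R) : -1 <= c <= 1 ->
    n%:R * tail D (b n + a n * e * c) @[n --> \oo] --> (1 + c / 2) `^ r.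
  move=> /lim; apply: cvg_compl_of_cvg_expn => n.
  by rewrite dist_cdf_ge0 -subr_ge0 tail_ge0.
have l1 : -1 <= (1 : R) <= 1 by apply/andP; split; lra.
have lN : -1 <= (-1 : R) <= 1 by apply/andP; split; lra.
have l0 : -1 <= (0 : R) <= 1 by apply/andP; split; lra.
have eL : \forall n \near \oo, 0 < b n - a n * e.
  have posF : \forall n \near \oo, 0 < dist_cdf D (b n + a n * e * -1) ^+ n.
    by apply: (cvgr_gt _ (lim _ lN)); exact: expR_gt0.
  (* At a nonpositive point the cdf vanishes, and so does its power; [n = 0] is excluded because
     [0 ^ 0 = 1]. *)
  apply: (filterS2 _ _ (nbhs_infty_gt 0%N) posF) => n n0; rewrite mulrN1.
  apply: contraTT; rewrite -!leNgt => h.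
  by rewrite (dist_cdf_eq0 h) expr0n gtn_eqF.
have : (1 + -1 / 2) `^ r * (1 + 1 / 2) `^ r <= (1 + 0 / 2) `^ r * (1 + 0 / 2) `^ r.
  apply: (ler_cvg_to (cvgM (limS _ lN) (limS _ l1)) (cvgM (limS _ l0) (limS _ l0))).
  apply: (filterS _ eL) => n bn /=.
  rewrite mulr1 mulr0 addr0 mulrN1 mulrACA [leRHS]mulrACA ler_wpM2l ?mulr_ge0// -expr2.
  apply: tail_midpoint; last lra.
  by rewrite mulr_ge0 ?ltW.
(* The product of the outer limits is [(3/4) ^ r], which exceeds 1 because [r < 0]. *)
rewrite mul0r addr0 powR1 mulr1 -powRM; [|lra|lra].
apply/negP; rewrite -ltNge.
rewrite /powR ifF; last lra.
by rewrite expR_gt1 nmulr_rgt0// ln_lt0//; lra.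
Qed.
End mhr.

Theorem theorem1p5 (R : realType) (D : probability (measurableTypeR R) R)
    (f : R -> R) (xs : \bar R) :
  is_density D f ->
  supported_on0 D xs ->
  MHR D f xs ->
  (forall gamma : R, max_attraction (dist_cdf D) gamma -> gamma <= 0) /\
  (forall gamma : R, min_attraction (dist_cdf D) gamma -> -1 <= gamma).
Proof.
move=> Df Dxs Dmhr; split=> gamma; first exact: (max_attraction_le Df Dxs Dmhr).
exact: (min_attraction_ge Df Dxs Dmhr).
Qed.
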